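(* The sets of matrices $\{Q[\mathbf f]:\mathbf f\in\mathcal{LIN}_n^+\}\subset\{Q[\mathbf f]:\mathbf f\in\mathcal{LIN}_n\}$ are star-shaped about $0$ in the vector space of real anti-symmetric $n\times n$ matrices.
   Context: Let $\mathcal G$ be the group of strictly increasing continuous maps $f:[-1,1]\to[-1,1]$ with $f(\pm1)=\pm1$, $i$ the identity, $\mathcal G_0=\{f\in\mathcal G:\int_{-1}^1 f=0\}$, $f^e(t)=\tfrac12(f(t)+f(-t))$. For $f,g\in\mathcal G$, $Q(f,g)=\int_{-1}^1 f(g^{-1}(t))\,dt$. For $\mathbf f=(f_1,\dots,f_n)$, $Q[\mathbf f]$ is the $n\times n$ matrix with entries $Q[\mathbf f]_{ij}=Q(f_j,f_i)$ (it is anti-symmetric). $\mathcal{LIN}_n$ is the set of $\mathbf f\in\mathcal G_0^n$ with $\{i,f_1,\dots,f_n\}$ linearly independent; $\mathcal{LIN}_n^+$ the set of $\mathbf f\in\mathcal G_0^n$ with $\{f_1^e,\dots,f_n^e\}$ linearly independent. A subset $C$ of a vector space $V$ is star-shaped about $0$ if for every nonzero $v\in V$ the set $\{x\in\mathbb R:xv\in C\}$ is an interval containing $0$ in its interior. *)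

(* Defs.v *)
From HB Require Import structures.
From mathcomp Require Import all_boot all_order all_algebra.
From mathcomp Require Import all_classical all_reals all_analysis.
Set Implicit Arguments. Unset Strict Implicit. Unset Printing Implicit Defensive.
Import Order.TTheory GRing.Theory Num.Theory numFieldNormedType.Exports.
Local Open Scope classical_set_scope.
Local Open Scope ring_scope.

Section Defs.
Variable R : realType.

Definition I11 : set R := `[-1, 1]%classic.

(* f belongs to the group G: strictly increasing continuous map [-1,1] -> [-1,1]
   with f(-1) = -1, f(1) = 1 (only the values on [-1,1] matter). *)
Definition inG (f : R -> R) : Prop :=
  {within I11, continuous f} /\
  (forall x, I11 x -> I11 (f x)) /\
  (forall x y, I11 x -> I11 y -> x < y -> f x < f y) /\
  f (-1) = -1 /\ f 1 = 1.

Definition int11 (f : R -> R) : R :=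
  (\int[@lebesgue_measure R]_(t in I11) f t)%R.

Definition inG0 (f : R -> R) : Prop := inG f /\ int11 f = 0.

(* inverse of g on [-1,1]: the (unique, when g \in G) s in [-1,1] with g s = t *)
Definition ginv (g : R -> R) (t : R) : R := xget 0 [set s | I11 s /\ g s = t].

Definition Q (f g : R -> R) : R := int11 (fun t => f (ginv g t)).

Definition feven (f : R -> R) : R -> R := fun t => (f t + f (- t)) / 2.

Definition Qmat (n : nat) (f : 'I_n -> R -> R) : 'M[R]_n :=
  \matrix_(i, j) Q (f j) (f i).

Definition LIN (n : nat) : set ('I_n -> R -> R) :=
  [set f | (forall j, inG0 (f j)) /\
     forall (a : R) (c : 'I_n -> R),
       (forall t, I11 t -> a * t + \sum_(j < n) c j * f j t = 0) ->
       a = 0 /\ forall j, c j = 0].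

Definition LINplus (n : nat) : set ('I_n -> R -> R) :=
  [set f | (forall j, inG0 (f j)) /\
     forall (c : 'I_n -> R),
       (forall t, I11 t -> \sum_(j < n) c j * feven (f j) t = 0) ->
       forall j, c j = 0].

Definition antisym (n : nat) : set 'M[R]_n := [set M | M^T = - M].

Definition star_shaped (n : nat) (V C : set 'M[R]_n) : Prop :=
  forall v, V v -> v != 0 ->
    is_interval [set x : R | C (x *: v)] /\
    exists2 e : R, 0 < e & forall x : R, `|x| < e -> C (x *: v).

End Defs.

(* Main.v *)
Require Import Defs.
From HB Require Import structures.
From mathcomp Require Import all_boot all_order all_algebra.
From mathcomp Require Import all_classical all_reals all_analysis.
From mathcomp Require Import ring lra.
Import Order.TTheory GRing.Theory Num.Theory numFieldNormedType.Exports.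
Local Open Scope classical_set_scope.
Local Open Scope ring_scope.

(**
  [Q f g] is the Stieltjes integral of [f] against [dg], hence bilinear and
  alternating, and it vanishes when one argument is the identity [i] and the
  other has mean zero. So replacing each [f_j] by [(1 - s) i + s f_j] multiplies
  the matrix by [s^2], and replacing it by [t |-> - f_j (- t)] multiplies it by
  [-1]; both operations preserve the two independence conditions. It remains to
  reach a small positive multiple of a given anti-symmetric [M]. Take
  [f_j = i + d (e_j + o_j)], where [e_j] is a difference of two cosines and
  [o_j] a combination of sines. Functions of equal parity are orthogonal for the
  form, so the matrix is [d^2] times the pairing of the [e]'s with the [o]'s,
  and the orthogonality of the trigonometric system lets one choose [o] so that
  this pairing is [M].
*)

(** * Trapezoidal sums of [f dg] on a uniform mesh, and a criterion for their convergence *)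

Section Trapezoid.
Set Implicit Arguments. Unset Strict Implicit.
Variable R : realType.
Implicit Types (f g h A V : R -> R) (m k : nat).

(** Index [m] stands for a mesh of [m.+1] equal cells, so the step [2 / m.+1] makes sense for every
    [m]. *)
Definition node m k : R := -1 + 2 * k%:R / m.+1%:R.

(* The trapezoidal sum of [f dg] up to the boundary term [f g / 2]; in this form
   bilinearity and antisymmetry are exact. *)
Definition trap m f g : R :=
  \sum_(k < m.+1)
    (f (node m k) * g (node m k.+1) - f (node m k.+1) * g (node m k)) / 2.

Lemma node0 m : node m 0 = -1.
Proof. by rewrite /node mulr0 mul0r addr0. Qed.

Lemma node_last m : node m m.+1 = 1.
Proof. by rewrite /node mulfK ?pnatr_eq0//; lra. Qed.

Lemma nodeS m k : node m k.+1 - node m k = 2 / m.+1%:R.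
Proof. by rewrite /node -[k.+1]addn1 natrD; field; rewrite addrC natr1 pnatr_eq0. Qed.

Lemma nodeS_gt0 m : 0 < 2 / m.+1%:R :> R.
Proof. by rewrite divr_gt0// ltr0n. Qed.

Lemma ltr_nodeS m k : node m k < node m k.+1.
Proof. by rewrite -subr_gt0 nodeS nodeS_gt0. Qed.

Lemma node_I11 m k : (k <= m.+1)%N -> I11 (node m k).
Proof.
move=> km; rewrite /I11/= in_itv/=; apply/andP; split.
  by rewrite /node lerDl divr_ge0// mulr_ge0.
rewrite -(node_last m) lerD2l ler_pM2r ?invr_gt0 ?ltr0n//.
by rewrite ler_pM2l ?ler_nat.
Qed.

Lemma node_rev m k : (k <= m.+1)%N -> node m (m.+1 - k) = - node m k.
Proof. by move=> km; rewrite /node natrB//; field; rewrite addrC natr1 pnatr_eq0. Qed.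

Lemma near_mesh_le (e : R) : 0 < e -> \forall m \near \oo, 2 / m.+1%:R <= e.
Proof.
move=> e0; near=> m.
have : `|0 - harmonic m| <= e / 2 :> R.
  near: m; apply: (cvgrPdist_le _ _).1; first exact: cvg_harmonic.
  by rewrite divr_gt0.
rewrite sub0r normrN ger0_norm ?harmonic_ge0// -[m.+1%:R^-1]/(harmonic m).
by move: (harmonic m) => z ?; lra.
Unshelve. all: by end_near. Qed.

Lemma eq_trap m f f' g g' : (forall t, I11 t -> f t = f' t) ->
  (forall t, I11 t -> g t = g' t) -> trap m f g = trap m f' g'.
Proof.
move=> ff gg; apply: eq_bigr => k _.
by rewrite !ff ?gg//; apply: node_I11 => //; exact: ltnW.
Qed.

Lemma trapC m f g : trap m g f = - trap m f g.
Proof. by rewrite /trap -sumrN; apply: eq_bigr => k _; field. Qed.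

Lemma trap_self m f : trap m f f = 0.
Proof. by rewrite /trap big1// => k _; field. Qed.

Lemma trapDl m f g h :
  trap m (fun t => f t + g t) h = trap m f h + trap m g h.
Proof. by rewrite /trap -big_split/=; apply: eq_bigr => k _; field. Qed.

Lemma trapZl m (a : R) f h : trap m (fun t => a * f t) h = a * trap m f h.
Proof. by rewrite /trap mulr_sumr; apply: eq_bigr => k _; field. Qed.

Lemma trapDr m f g h :
  trap m h (fun t => f t + g t) = trap m h f + trap m h g.
Proof. by rewrite trapC trapDl opprD -!trapC. Qed.

Lemma trapZr m (a : R) f h : trap m h (fun t => a * f t) = a * trap m h f.
Proof. by rewrite trapC trapZl -mulrN -trapC. Qed.

Lemma trap_suml m n (F : 'I_n -> R -> R) h :
  trap m (fun t => \sum_(j < n) F j t) h = \sum_(j < n) trap m (F j) h.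
Proof.
rewrite /trap exchange_big/=; apply: eq_bigr => k _.
by rewrite !mulr_suml -sumrB mulr_suml.
Qed.

Lemma trap_sumr m n (F : 'I_n -> R -> R) h :
  trap m h (fun t => \sum_(j < n) F j t) = \sum_(j < n) trap m h (F j).
Proof. by rewrite trapC trap_suml -sumrN; apply: eq_bigr => j _; rewrite -trapC. Qed.

(** The reflection [t |-> - t] permutes the nodes and swaps the two ends of each cell, and the
    summand is alternating in these ends. *)
Lemma trap_rev m f g :
  trap m (fun t => f (- t)) (fun t => g (- t)) = - trap m f g.
Proof.
rewrite /trap (reindex_inj rev_ord_inj)/= -sumrN; apply: eq_bigr => k _.
have km := ltn_ord k.
have -> : (m.+1 - k.+1).+1 = (m.+1 - k)%N by rewrite subSS subSn// -ltnS.
by rewrite !node_rev ?opprK//; [field | exact: ltnW].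
Qed.

(** Reversal changes the sign of the sum, while parity multiplies it by [a * b = 1]; the sum is
    therefore its own opposite. The useful cases are [a = b = 1] and [a = b = -1]. *)
Lemma trap_parity m (a b : R) f g : a * b = 1 ->
  (forall t, f (- t) = a * f t) -> (forall t, g (- t) = b * g t) ->
  trap m f g = 0.
Proof.
move=> ab fa gb; have := trap_rev m f g.
rewrite (@eq_trap _ _ (fun t => a * f t) _ (fun t => b * g t))//.
by rewrite trapZl trapZr mulrA ab mul1r; lra.
Qed.

(* [V] gauges the error of a cell: [V = f] serves for monotone pairs, and
   [V = id] for smooth ones. *)
Lemma trap_cvg A f g V :
  (forall e : R, 0 < e -> \forall m \near \oo, forall k, (k < m.+1)%N ->
     let s := node m k in let t := node m k.+1 in
     `|A t - A s - (f s * g t - f t * g s) / 2| <= e * (V t - V s)) ->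
  trap m f g @[m --> \oo] --> A 1 - A (-1).
Proof.
move=> cell; apply/cvgrPdist_le => e e0.
(* The cell errors telescope to at most [e / v * (V 1 - V (-1))]; the added 1 keeps [v] positive
   when [V] has equal end values. *)
set v := `|V 1 - V (-1)| + 1.
have v0 : 0 < v by rewrite ltr_wpDl.
have /cell : 0 < e / v by rewrite divr_gt0.
apply: filterS => m cellm.
have tel (F : R -> R) :
    F 1 - F (-1) = \sum_(k < m.+1) (F (node m k.+1) - F (node m k)).
  rewrite -(big_mkord xpredT (fun k => F (node m k.+1) - F (node m k))).
  by rewrite (telescope_sumr (fun k => F (node m k)))// node0 node_last.
rewrite (tel A) -sumrB; apply: le_trans (ler_norm_sum _ _ _) _.
apply: (@le_trans _ _ (\sum_(k < m.+1) e / v * (V (node m k.+1) - V (node m k)))).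
  by apply: ler_sum => k _; exact: cellm.
rewrite -mulr_sumr -tel -mulrA; apply: ler_piMr; first exact: ltW.
by rewrite ler_pdivrMl// mulr1 (le_trans (ler_norm _))// lerDl.
Qed.

Lemma I11_continuous_dist g (x e : R) : {within @I11 R, continuous g} -> I11 x ->
  0 < e -> \forall y \near x, I11 y -> `|g x - g y| < e.
Proof.
move=> /subspace_continuousP cg /cg /cvgrPdist_lt /(_ e) /[apply].
by rewrite near_withinE.
Qed.

(** Uniform continuity on a compact interval, phrased in terms of the mesh size. *)
Lemma uniform_mesh g (e : R) : {within @I11 R, continuous g} -> 0 < e ->
  \forall m \near \oo, forall s t, I11 s -> I11 t -> `|t - s| <= 2 / m.+1%:R ->
    `|g t - g s| <= e.
Proof.
move=> cg e0.
have /compact_near_coveringP cI : compact (@I11 R) by exact: segment_compact.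
have {}cI := cI _ _ (fun m s => forall t, I11 s -> I11 t ->
   `|t - s| <= 2 / m.+1%:R -> `|g t - g s| <= e) eventually_filter.
have {cI} : \forall m \near \oo, @I11 R `<=` (fun s => forall t, I11 s -> I11 t ->
   `|t - s| <= 2 / m.+1%:R -> `|g t - g s| <= e).
  apply: cI => x Ix.
  have e2 : 0 < e / 2 by rewrite divr_gt0.
  have /nbhs_ballP[d /= d0 xd] := I11_continuous_dist cg Ix e2.
  have d2 : 0 < d / 2 by rewrite divr_gt0.
  (* Half of the radius is spent on the position of [y] and half on the mesh, so that both [y] and
     [t] lie within [d] of [x]. *)
  exists (ball x (d / 2), [set m | 2 / m.+1%:R <= d / 2]).
    by split; [exact: nbhsx_ballx | exact: near_mesh_le].
  move=> [y m] [/= xy md] t Iy It yt.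
  have {md} yt : `|t - y| <= d / 2 := le_trans yt md.
  have /= gy := xd y _ Iy; have /= gt := xd t _ It.
  have /gy {}gy : `|x - y| < d by apply: lt_trans xy _; lra.
  have /gt {}gt : `|x - t| < d.
    rewrite (_ : x - t = (x - y) - (t - y)); last by ring.
    by have := ler_normB (x - y) (t - y); have : `|x - y| < d / 2 := xy; lra.
  rewrite (_ : g t - g y = (g x - g y) - (g x - g t)); last by ring.
  by have := ler_normB (g x - g y) (g x - g t); lra.
by apply: filterS => m K s t Is It; exact: K.
Qed.
End Trapezoid.

(** * The sums converge to [Q] for functions of the group *)

Section QLimit.
Set Implicit Arguments. Unset Strict Implicit.
Variable R : realType.
Implicit Types (f g : R -> R).

Local Notation mu := (@lebesgue_measure R).

Lemma I11_le (t : R) : I11 t <-> -1 <= t <= 1.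
Proof. by rewrite /I11/= in_itv. Qed.

Lemma I11_1 : I11 (1 : R).
Proof. by apply/I11_le; lra. Qed.

Lemma inG_le f s t : inG f -> I11 s -> I11 t -> s <= t -> f s <= f t.
Proof.
move=> [_ [_ [f_inc _]]] Is It; rewrite le_eqVlt => /predU1P[->//|st].
by rewrite ltW// f_inc.
Qed.

Lemma inG_le_mono f s t : inG f -> I11 s -> I11 t -> (f s <= f t) = (s <= t).
Proof.
move=> Gf Is It; apply/idP/idP; last exact: inG_le.
have [_ [_ [f_inc _]]] := Gf.
by apply: contraTT; rewrite -!ltNge; exact: f_inc.
Qed.

Lemma inG_inj f s t : inG f -> I11 s -> I11 t -> f s = f t -> s = t.
Proof.
move=> Gf Is It fst; apply/eqP.
by rewrite eq_le -(inG_le_mono Gf Is It) -(inG_le_mono Gf It Is) fst lexx.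
Qed.

Lemma ginvP g t : inG g -> I11 t -> I11 (ginv g t) /\ g (ginv g t) = t.
Proof.
move=> Gg It; apply: (@xgetPex _ 0 [set s | I11 s /\ g s = t]).
have [cg [_ [_ [gN1 g1]]]] := Gg.
have N11 : -1 <= 1 :> R by lra.
have [|c] := IVT N11 cg (v := t); first by rewrite gN1 g1 min_l// max_r//; apply/I11_le.
by exists c.
Qed.

Lemma ginvK g s : inG g -> I11 s -> ginv g (g s) = s.
Proof.
move=> Gg Is; have [_ [gI _]] := Gg; have [Igi ggi] := ginvP Gg (gI _ Is).
exact: inG_inj Igi Is ggi.
Qed.

Lemma ginv_le g s t : inG g -> I11 s -> I11 t -> s <= t -> ginv g s <= ginv g t.
Proof.
move=> Gg Is It st; have [? gs] := ginvP Gg Is; have [? gt] := ginvP Gg It.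
by rewrite -(inG_le_mono Gg)// gs gt.
Qed.

(** Retraction of the line onto [I11]. Composing with it makes [f \o ginv g] monotone on the whole
    line, hence measurable. *)
Definition clamp (t : R) : R := Order.max (-1) (Order.min t 1).

Lemma clamp_I11 t : I11 (clamp t).
Proof.
apply/I11_le; rewrite /clamp le_max lexx/= ge_max ge_min lexx orbT andbT; lra.
Qed.

Lemma clampE t : I11 t -> clamp t = t.
Proof. by move=> /I11_le/andP[? ?]; rewrite /clamp min_l// max_r. Qed.

Lemma clamp_le s t : s <= t -> clamp s <= clamp t.
Proof. by move=> st; rewrite /clamp le_max2// le_min2. Qed.

Lemma integrable_comp_ginv f g : inG f -> inG g ->
  mu.-integrable (@I11 R) (EFin \o (f \o ginv g)).
Proof.
move=> Gf Gg; apply: measurable_bounded_integrable => //.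
- exact: measurable_itv.
- exact/compact_finite_measure/segment_compact.
- apply: (@eq_measurable_fun _ _ _ _ _ (f \o ginv g \o clamp)).
    by move=> t /[!inE] It; rewrite /= clampE.
  apply: measurable_realfun.nondecreasing_measurable; first exact: measurable_itv.
  move=> s t st /=; have Is := clamp_I11 s; have It := clamp_I11 t.
  apply: (inG_le Gf); [exact: (ginvP Gg Is).1 | exact: (ginvP Gg It).1|].
  by apply: ginv_le => //; exact: clamp_le.
- exists 1; split; first exact: num_real.
  move=> M M1 t It /=; have [_ [fI _]] := Gf.
  have /I11_le := fI _ (ginvP Gg It).1; rewrite -ler_norml => /le_trans; apply.
  exact: ltW.
Qed.

(** Under the substitution [x = g t] this is the Stieltjes integral of [f dg] from [-1] to [t]. *)
Let P f g (x : R) : R := \int[mu]_(t in `[-1, x]) f (ginv g t).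

(** On []g s, g t]] the values of [ginv g] lie between [s] and [t], so the integrand lies between
    [f s] and [f t]. *)
Let P_cell f g s t : inG f -> inG g -> I11 s -> I11 t -> s <= t ->
  f s * (g t - g s) <= P f g (g t) - P f g (g s) <= f t * (g t - g s).
Proof.
move=> Gf Gg Is It st; have [_ [gI _]] := Gg.
have gst : g s <= g t by exact: inG_le.
have /I11_le/andP[gs1 gs2] := gI _ Is; have /I11_le/andP[gt1 gt2] := gI _ It.
have int_fg := integrable_comp_ginv Gf Gg.
have int_sub (A : set R) : measurable A -> A `<=` @I11 R ->
    mu.-integrable A (EFin \o (f \o ginv g)).
  by move=> mA AI; apply: integrableS int_fg => //; exact: measurable_itv.
have int_t : mu.-integrable `[-1, g t] (EFin \o (f \o ginv g)).
  apply: int_sub; first exact: measurable_itv.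
  by move=> x/=; rewrite in_itv/= => xt; apply/I11_le; lra.
rewrite /P (Rintegral_itvB int_t)//.
have mst : measurable `]g s, g t] by exact: measurable_itv.
have stI : `]g s, g t] `<=` @I11 R.
  by move=> x/=; rewrite in_itv/= => xt; apply/I11_le; lra.
have int_cst (c : R) : mu.-integrable `]g s, g t] (EFin \o (fun _ : R => c)).
  have int_I11 : mu.-integrable (@I11 R) (EFin \o (fun _ : R => c)).
    apply: continuous_compact_integrable; first exact: segment_compact.
    by apply: continuous_subspaceT => x; exact: cst_continuous.
  by apply: integrableS int_I11 => //; exact: measurable_itv.
have cstE (c : R) : \int[mu]_(x in `]g s, g t]) c = c * (g t - g s).
  rewrite Rintegral_cst// /= lebesgue_measure_itv/= lte_fin.
  case: ifPn => [_|]; first by rewrite -EFinD.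
  by rewrite -leNgt => tgs; rewrite (_ : g t = g s) ?subrr//; lra.
rewrite -(cstE (f s)) -(cstE (f t)).
apply/andP; split; apply: le_Rintegral => //; first exact: int_sub.
- move=> x xst; have Ix := stI _ xst; move: xst; rewrite /= in_itv/= => xst.
  apply: inG_le => //; first exact: (ginvP Gg Ix).1.
  by rewrite -[s](ginvK Gg)//; apply: ginv_le => //; [exact: gI|lra].
- exact: int_sub.
- move=> x xst; have Ix := stI _ xst; move: xst; rewrite /= in_itv/= => xst.
  apply: inG_le => //; first exact: (ginvP Gg Ix).1.
  by rewrite -[t](ginvK Gg)//; apply: ginv_le => //; [exact: gI|lra].
Qed.

Lemma trap_cvgQ f g : inG f -> inG g -> trap m f g @[m --> \oo] --> Q f g.
Proof.
move=> Gf Gg; have [_ [fI [_ [fN1 f1]]]] := Gf; have [cg [_ [_ [gN1 g1]]]] := Gg.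
(* The subtracted half product is the boundary term missing from [trap]. It contributes nothing to
   [A 1 - A (-1)], since [f * g] equals 1 at both ends. *)
pose A t := P f g (g t) - f t * g t / 2.
have -> : Q f g = A 1 - A (-1).
  rewrite /A g1 gN1 f1 fN1 /P set_itv1 Rintegral_set1 /Q /int11 /I11.
  by lra.
apply: (@trap_cvg _ _ _ _ f) => e e0.
have := uniform_mesh cg e0; apply: filterS => m gm k km.
have Is : I11 (node R m k) by apply: node_I11; exact: ltnW.
have It : I11 (node R m k.+1) by exact: node_I11.
have st := ltW (ltr_nodeS R m k).
have := gm _ _ Is It; rewrite nodeS ger0_norm ?(ltW (nodeS_gt0 R m))// => /(_ (lexx _)).
have := P_cell Gf Gg Is It st; have := inG_le Gf Is It st.
have := inG_le Gg Is It st.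
rewrite /A; set s := node R m k; set t := node R m k.+1.
move: (f s) (f t) (g s) (g t) (P f g _) (P f g _) => fs ft gs gt Ps Pt.
move=> gst fst /andP[lo hi] /ler_normlP[_ ge].
(* The cell error is [Pt - Ps - (fs + ft) / 2 * (gt - gs)], which [P_cell] bounds by half of
   [(ft - fs) * (gt - gs)]; uniform continuity of [g] makes this small relative to [ft - fs]. *)
have fge : (ft - fs) * (gt - gs) <= e * (ft - fs).
  by rewrite mulrC; apply: ler_wpM2r => //; lra.
rewrite ler_norml; apply/andP; split; nra.
Qed.
End QLimit.

(** * Convergence for differentiable pairs, and the pairings of sines and cosines *)

Section SmoothPairs.
Set Implicit Arguments. Unset Strict Implicit.
Variable R : realType.
Implicit Types (f g A : R -> R).

Lemma is_derive_add f g (x a b : R) : is_derive x 1 f a -> is_derive x 1 g b ->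
  is_derive x 1 (fun t => f t + g t) (a + b).
Proof. by move=> fa gb; exact: is_deriveD. Qed.

Lemma is_derive_mul f g (x a b : R) : is_derive x 1 f a -> is_derive x 1 g b ->
  is_derive x 1 (fun t => f t * g t) (f x * b + g x * a).
Proof. by move=> fa gb; exact: is_deriveM. Qed.

Lemma is_derive_scale f (c x a : R) : is_derive x 1 f a ->
  is_derive x 1 (fun t => c * f t) (c * a).
Proof.
move=> fa; have := is_derive_mul (is_derive_cst c x 1) fa.
by rewrite mulr0 addr0.
Qed.

Lemma derive_continuous f (df : R -> R) (s t : R) : (forall x : R, is_derive x 1 f (df x)) ->
  {within `[s, t], continuous f}.
Proof.
move=> fd; apply: continuous_subspaceT => x.
by apply: differentiable_continuous; apply/derivable1_diffP; exact: ex_derive.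
Qed.

Definition lipschitz_real f :=
  exists K : R, forall s t, s <= t -> `|f t - f s| <= K * (t - s).

Lemma derive_bounded_lipschitz f (df : R -> R) (K : R) :
  (forall x : R, is_derive x 1 f (df x)) -> (forall x, `|df x| <= K) ->
  forall s t, s <= t -> `|f t - f s| <= K * (t - s).
Proof.
move=> fd dfK s t st.
have [c _ ->] := MVT_segment st (fun x _ => fd x) (derive_continuous fd).
by rewrite normrM (ger0_norm (x := t - s)) ?subr_ge0// ler_wpM2r ?subr_ge0.
Qed.

(** The limit is the integral of [(f g' - f' g) / 2], supplied through an antiderivative [A]. The
    mean value theorem bounds the error of a cell by [K ^+ 2] times the squared step. *)
Lemma trap_cvg_derive f g A (df dg : R -> R) (K : R) :
  (forall x : R, is_derive x 1 f (df x)) -> (forall x : R, is_derive x 1 g (dg x)) ->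
  (forall x : R, is_derive x 1 A ((f x * dg x - df x * g x) / 2)) ->
  (forall x, `|df x| <= K) -> (forall x, `|dg x| <= K) ->
  trap m f g @[m --> \oo] --> A 1 - A (-1).
Proof.
move=> fd gd Ad dfK dgK; apply: (@trap_cvg _ _ _ _ id) => e e0.
have K0 : 0 <= K by exact: le_trans (normr_ge0 (df 0)) _.
have K1 : 0 < K ^+ 2 + 1 by rewrite ltr_wpDl ?sqr_ge0.
have := near_mesh_le (divr_gt0 e0 K1); apply: filterS => m me k km.
have : node R m k <= node R m k.+1 by apply: ltW; exact: ltr_nodeS.
move: (nodeS R m k); set s := node R m k; set t := node R m k.+1 => mesh st.
have {}me : K ^+ 2 * (t - s) <= e.
  move: me; rewrite -mesh ler_pdivlMr// => me.
  by apply: le_trans me; rewrite mulrC ler_wpM2l ?subr_ge0//; lra.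
(* The left end [s] is frozen: the subtracted term vanishes at [x = s], so [D t - D s] is exactly
   the cell error, and the derivative of [D] is of the order of [x - s]. *)
pose D x := A x - (f s * g x - f x * g s) / 2.
have Dd (x : R) : is_derive x 1 D (((f x - f s) * dg x - df x * (g x - g s)) / 2).
  have -> : D = (fun y => A y + (- (f s / 2) * g y + (g s / 2) * f y)).
    by apply/funext => y; rewrite /D; field.
  apply: (is_derive_eq (is_derive_add (Ad x)
    (is_derive_add (is_derive_scale _ (gd x)) (is_derive_scale _ (fd x))))).
  by field.
have [c cst] := MVT_segment st (fun x _ => Dd x) (derive_continuous Dd).
have -> : D t - D s = A t - A s - (f s * g t - f t * g s) / 2 by rewrite /D; lra.
move=> ->; rewrite normrM (ger0_norm (x := t - s)) ?subr_ge0//.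
rewrite ler_wpM2r ?subr_ge0//; apply: le_trans me.
move: cst; rewrite in_itv/= => /andP[sc ct].
have fc := derive_bounded_lipschitz fd dfK sc.
have gc := derive_bounded_lipschitz gd dgK sc.
rewrite normrM (ger0_norm (x := 2^-1)) ?invr_ge0// ler_pdivrMr//.
apply: le_trans (ler_normB _ _) _; rewrite !normrM.
have := ler_pM (normr_ge0 _) (normr_ge0 _) fc (dgK c).
have := ler_pM (normr_ge0 _) (normr_ge0 _) (dfK c) gc.
have : K * K * (c - s) <= K * K * (t - s) by rewrite ler_wpM2l ?mulr_ge0//; lra.
by rewrite expr2; lra.
Qed.

Lemma is_derive_linear (a x : R) : is_derive x 1 (fun t => a * t) a.
Proof.
by have := is_derive_scale a (is_derive_id x 1); rewrite mulr1.
Qed.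

Lemma is_derive_sin_linear (a x : R) :
  is_derive x 1 (fun t => sin (a * t)) (a * cos (a * x)).
Proof.
have := is_derive1_comp (is_derive_sin (a * x)) (is_derive_linear a x).
by rewrite mulrC.
Qed.

Lemma is_derive_cos_linear (a x : R) :
  is_derive x 1 (fun t => cos (a * t)) (- (a * sin (a * x))).
Proof.
have := is_derive1_comp (is_derive_cos (a * x)) (is_derive_linear a x).
by rewrite mulNr mulrC.
Qed.

(** Only even multiples of [pi] occur, so that every cosine takes the value 1 at both ends of the
    interval and differences of cosines vanish there. *)
Definition freq (k : nat) : R := pi *+ 2 * k%:R.

Lemma freq_gt0 k : (0 < k)%N -> 0 < freq k.
Proof. by move=> k0; rewrite mulr_gt0 ?ltr0n// pmulrn_lgt0// pi_gt0. Qed.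

Lemma cos_freq k : cos (freq k) = 1.
Proof.
by rewrite /freq mulr_natr -[X in cos X]add0r (periodicn (@cosD2pi R)) cos0.
Qed.

Lemma sin_freq k : sin (freq k) = 0.
Proof.
by rewrite /freq mulr_natr -[X in sin X]add0r (periodicn (@sinD2pi R)) sin0.
Qed.

(** The cosine integrates to 0; the value [-1] is the boundary term left out by [trap]. Being
    independent of [k], it cancels in a difference of two cosines. *)
Lemma trap_cos_id k : (0 < k)%N ->
  trap m (fun t => cos (freq k * t)) id @[m --> \oo] --> (-1 : R).
Proof.
move=> /freq_gt0 k0; have := cos_freq k; have := sin_freq k.
move: (freq k) k0 => a a0 sa ca.
pose A t := sin (a * t) / a - t * cos (a * t) / 2.
have -> : -1 = A 1 - A (-1).
  by rewrite /A !mulrN !mulr1 sinN cosN sa ca; field; rewrite gt_eqF.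
have dA (x : R) : is_derive x 1 A
   ((cos (a * x) * 1 - (- (a * sin (a * x))) * x) / 2).
  have -> : A = (fun y => a^-1 * sin (a * y) + (- 2^-1) * (y * cos (a * y))).
    by apply/funext => y; rewrite /A; field; rewrite gt_eqF.
  apply: (is_derive_eq (is_derive_add (is_derive_scale _ (is_derive_sin_linear a x))
    (is_derive_scale _ (is_derive_mul (is_derive_id x 1) (is_derive_cos_linear a x))))).
  by field; rewrite gt_eqF.
have did (x : R) : is_derive x 1 (@id R) ((fun=> 1) x) by exact: is_derive_id.
apply: (trap_cvg_derive (is_derive_cos_linear a) did dA (K := a + 1)).
- move=> x; rewrite normrN normrM gtr0_norm//.
  by have := sin_max (a * x); have := normr_ge0 (sin (a * x)); nra.
- by move=> x; rewrite normr1; lra.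
Qed.

Lemma trap_sin_cos k l : (0 < k)%N -> (0 < l)%N ->
  trap m (fun t => sin (freq k * t)) (fun t => cos (freq l * t)) @[m --> \oo]
    --> - (freq k * (l == k)%:R).
Proof.
move=> k0 l0.
have bnd x : `|freq k * cos (freq k * x)| <= freq k + freq l.
  rewrite normrM gtr0_norm ?freq_gt0//.
  have := cos_max (freq k * x); have := normr_ge0 (cos (freq k * x)).
  by have := freq_gt0 k0; have := freq_gt0 l0; nra.
have bnd' x : `|- (freq l * sin (freq l * x))| <= freq k + freq l.
  rewrite normrN normrM gtr0_norm ?freq_gt0//.
  have := sin_max (freq l * x); have := normr_ge0 (sin (freq l * x)).
  by have := freq_gt0 k0; have := freq_gt0 l0; nra.
have cvg_antideriv A : (forall x : R, is_derive x 1 A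
      ((sin (freq k * x) * - (freq l * sin (freq l * x)) -
        freq k * cos (freq k * x) * cos (freq l * x)) / 2)) ->
    trap m (fun t => sin (freq k * t)) (fun t => cos (freq l * t)) @[m --> \oo]
      --> A 1 - A (-1).
  move=> dA; exact: (trap_cvg_derive (is_derive_sin_linear (freq k))
    (is_derive_cos_linear (freq l)) dA bnd bnd').
have [E|kl] := eqVneq l k.
  (* For equal frequencies the integrand is the constant [- (freq k / 2)], because the squares of
     sine and cosine add up to 1. *)
  rewrite mulr1; have -> : - freq k = (- (freq k / 2) * 1) - (- (freq k / 2) * (-1)).
    by field.
  move: (cvg_antideriv); rewrite E => /(_ (fun t => - (freq k / 2) * t)); apply => x.
  apply: (is_derive_eq (is_derive_linear _ x)).
  transitivity (- (freq k / 2) * (cos (freq k * x) ^+ 2 + sin (freq k * x) ^+ 2)).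
    by rewrite cos2Dsin2 mulr1.
  by field.
rewrite mulr0 oppr0.
have ab : freq k - freq l != 0.
  rewrite /freq -mulrBr; apply: mulf_neq0; last by rewrite subr_eq0 eqr_nat eq_sym.
  by rewrite gt_eqF// pmulrn_lgt0// pi_gt0.
have ab' : freq k + freq l != 0 by rewrite gt_eqF// addr_gt0 ?freq_gt0.
(* Antiderivative obtained from the product-to-sum formulas; its sines vanish at both ends. *)
pose A t := - 4^-1 * ((freq k + freq l) / (freq k - freq l) * sin ((freq k - freq l) * t) +
                 (freq k - freq l) / (freq k + freq l) * sin ((freq k + freq l) * t)).
have -> : 0 = A 1 - A (-1).
  by rewrite /A !mulrN !mulr1 !sinN sinB sinD !sin_freq; field; rewrite ab ab'.
apply: cvg_antideriv => x; apply: (is_derive_eq (is_derive_scale _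
  (is_derive_add (is_derive_scale _ (is_derive_sin_linear _ x))
    (is_derive_scale _ (is_derive_sin_linear _ x))))).
rewrite [(freq k - freq l) * x]mulrBl [(freq k + freq l) * x]mulrDl cosB cosD.
by field; rewrite ab ab'.
Qed.
End SmoothPairs.

(** * Calculus of the limit pairing, and the two operations on functions of the group *)

Section Stieltjes.
Set Implicit Arguments. Unset Strict Implicit.
Variable R : realType.
Implicit Types (f g h : R -> R) (p q : R).

(** A relation between functions and a value, so that the pairing and its bilinearity also apply
    outside the group, in particular to sines and cosines, where [ginv] does not give an inverse. *)
Definition tlim f g q := trap m f g @[m --> \oo] --> q.

Lemma tlim_unique f g p q : tlim f g p -> tlim f g q -> p = q.
Proof. by move=> fp fq; exact: (cvg_unique (@Rhausdorff R) fp fq). Qed.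

Lemma tlim_const f g q : (forall m, trap m f g = q) -> tlim f g q.
Proof. by move=> fgq; rewrite /tlim; under eq_cvg do rewrite fgq; exact: cvg_cst. Qed.

Lemma tlim_eq f f' g g' q : (forall t, I11 t -> f t = f' t) ->
  (forall t, I11 t -> g t = g' t) -> tlim f' g' q -> tlim f g q.
Proof. by move=> ff gg; rewrite /tlim; under eq_cvg do rewrite -(eq_trap _ ff gg). Qed.

Lemma tlimC f g q : tlim f g q -> tlim g f (- q).
Proof. by rewrite /tlim; under [X in _ -> X]eq_cvg do rewrite trapC; exact: cvgN. Qed.

Lemma tlimDl f g h p q : tlim f h p -> tlim g h q ->
  tlim (fun t => f t + g t) h (p + q).
Proof. by rewrite /tlim; under [X in _ -> _ -> X]eq_cvg do rewrite trapDl; exact: cvgD. Qed.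

Lemma tlimZl (a : R) f h p : tlim f h p -> tlim (fun t => a * f t) h (a * p).
Proof. by rewrite /tlim; under [X in _ -> X]eq_cvg do rewrite trapZl; exact: cvgMl_tmp. Qed.

Lemma tlimDr f g h p q : tlim h f p -> tlim h g q ->
  tlim h (fun t => f t + g t) (p + q).
Proof. by rewrite /tlim; under [X in _ -> _ -> X]eq_cvg do rewrite trapDr; exact: cvgD. Qed.

Lemma tlimZr (a : R) f h p : tlim h f p -> tlim h (fun t => a * f t) (a * p).
Proof. by rewrite /tlim; under [X in _ -> X]eq_cvg do rewrite trapZr; exact: cvgMl_tmp. Qed.

Lemma cvg_sum_ord n (u : 'I_n -> nat -> R) (l : 'I_n -> R) :
  (forall j, u j m @[m --> \oo] --> l j) ->
  \sum_(j < n) u j m @[m --> \oo] --> \sum_(j < n) l j.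
Proof.
elim: n u l => [|n IH] u l ul.
  by rewrite big_ord0; under eq_cvg do rewrite big_ord0; exact: cvg_cst.
rewrite big_ord_recr/=; under eq_cvg do rewrite big_ord_recr/=.
by apply: cvgD => //; apply: IH => j.
Qed.

Lemma tlim_suml n (F : 'I_n -> R -> R) h (q : 'I_n -> R) :
  (forall j, tlim (F j) h (q j)) ->
  tlim (fun t => \sum_(j < n) F j t) h (\sum_(j < n) q j).
Proof.
by move=> Fq; rewrite /tlim; under eq_cvg do rewrite trap_suml; exact: cvg_sum_ord.
Qed.

Lemma tlim_sumr n (F : 'I_n -> R -> R) h (q : 'I_n -> R) :
  (forall j, tlim h (F j) (q j)) ->
  tlim h (fun t => \sum_(j < n) F j t) (\sum_(j < n) q j).
Proof.
by move=> Fq; rewrite /tlim; under eq_cvg do rewrite trap_sumr; exact: cvg_sum_ord.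
Qed.

Lemma inG_id : inG (@id R).
Proof.
split; first by apply: continuous_subspaceT => x; exact: cvg_id.
by split=> //; split.
Qed.

Lemma int11E f : int11 f = Q f id.
Proof.
apply: eq_Rintegral => t /[!inE] It /=.
by have /= -> := ginvK inG_id It.
Qed.

Lemma tlim_Q f g q : inG f -> inG g -> tlim f g q -> Q f g = q.
Proof. by move=> Gf Gg; apply: tlim_unique; exact: trap_cvgQ. Qed.

(** The mean of [f] is its pairing with the identity, so the mean-zero condition can be handled by
    bilinearity. *)
Lemma inG0P f : inG0 f <-> inG f /\ tlim f id 0.
Proof.
split=> -[Gf If]; split=> //; last by rewrite int11E; exact: tlim_Q inG_id If.
by rewrite -If int11E; exact: trap_cvgQ inG_id.
Qed.

Lemma I11N (t : R) : I11 t -> I11 (- t).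
Proof. by move=> /I11_le It; apply/I11_le; lra. Qed.

Lemma I11_continuousP f : {within @I11 R, continuous f} <->
  forall x e, I11 x -> 0 < e ->
    exists2 d, 0 < d & forall y, I11 y -> `|x - y| < d -> `|f x - f y| < e.
Proof.
split=> [cf x e Ix e0|H].
  have /nbhs_ballP[d /= d0 xd] := I11_continuous_dist cf Ix e0.
  by exists d => // y Iy xy; exact: xd.
apply/subspace_continuousP => x Ix; apply/cvgrPdist_lt => e /(H _ _ Ix)[d d0 xd].
by rewrite near_withinE; apply/nbhs_ballP; exists d => // y xy Iy; exact: xd.
Qed.

Lemma continuous_comb (a b : R) f : {within @I11 R, continuous f} ->
  {within @I11 R, continuous (fun t => a * t + b * f t)}.
Proof.
move=> cf x; apply: (@cvgD _ _ _ _ _ (fun t => a * t) (fun t => b * f t)).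
  apply: cvgMl_tmp; apply: (@continuous_subspaceT _ _ _ id) => y; exact: cvg_id.
by apply: cvgMl_tmp; exact: cf.
Qed.

Definition mix (s : R) f (t : R) : R := (1 - s) * t + s * f t.
Definition central_refl f (t : R) : R := - f (- t).

Lemma inG_mix s f : 0 < s <= 1 -> inG f -> inG (mix s f).
Proof.
move=> s01 [cf [fI [f_inc [fN1 f1]]]]; split; first exact: continuous_comb.
split=> [x Ix|].
  have /I11_le := fI x Ix; have /I11_le := Ix => ? ?.
  by apply/I11_le; rewrite /mix; nra.
split=> [x y Ix Iy xy|]; first by have := f_inc _ _ Ix Iy xy; rewrite /mix; nra.
by rewrite /mix fN1 f1; lra.
Qed.

Lemma inG_refl f : inG f -> inG (central_refl f).
Proof.
move=> [/I11_continuousP cf [fI [f_inc [fN1 f1]]]]; split.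
  apply/I11_continuousP => x e Ix e0.
  have [d d0 xd] := cf _ _ (I11N Ix) e0; exists d => // y Iy xy.
  rewrite /central_refl -opprD normrN; apply: xd; first exact: I11N.
  by rewrite -opprD normrN.
split=> [x /I11N/fI/I11N//|].
split=> [x y Ix Iy xy|]; last by rewrite /central_refl opprK fN1 f1 opprK.
by rewrite /central_refl ltrN2 f_inc ?ltrN2//; exact: I11N.
Qed.

Lemma tlim_mix s f g q : inG0 f -> inG0 g -> tlim f g q ->
  tlim (mix s f) (mix s g) (s ^+ 2 * q).
Proof.
move=> /inG0P[_ f0] /inG0P[_ g0] fgq.
(* The four terms of the bilinear expansion: identity with itself gives 0, the two cross terms
   vanish because [f] and [g] have mean zero, and only the last survives. *)
have -> : s ^+ 2 * q = (1 - s) * ((1 - s) * 0 + s * - 0) + s * ((1 - s) * 0 + s * q).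
  by ring.
apply: tlimDl; apply: tlimZl; apply: tlimDr; apply: tlimZr => //.
  by apply: tlim_const => m; rewrite trap_self.
exact: tlimC.
Qed.

Lemma inG0_mix s f : 0 < s <= 1 -> inG0 f -> inG0 (mix s f).
Proof.
move=> s01 /inG0P[Gf f0]; apply/inG0P; split; first exact: inG_mix.
have -> : 0 = (1 - s) * 0 + s * 0 :> R by ring.
apply: tlimDl; apply: tlimZl => //.
by apply: tlim_const => m; rewrite trap_self.
Qed.

Lemma tlim_refl f g q : tlim f g q -> tlim (central_refl f) (central_refl g) (- q).
Proof.
rewrite /tlim => fgq.
have tr m : trap m (central_refl f) (central_refl g) = - trap m f g.
  rewrite -trap_rev /trap; apply: eq_bigr => k _; rewrite /central_refl; ring.
by under eq_cvg do rewrite tr; exact: cvgN.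
Qed.

Lemma inG0_refl f : inG0 f -> inG0 (central_refl f).
Proof.
move=> /inG0P[Gf /tlim_refl f0]; apply/inG0P; split; first exact: inG_refl.
(* The identity is its own central reflection, so the pairing with it only changes sign. *)
rewrite -oppr0; apply: tlim_eq f0 => // t _; by rewrite /central_refl opprK.
Qed.

Lemma Q_mix s f g : 0 < s <= 1 -> inG0 f -> inG0 g ->
  Q (mix s f) (mix s g) = s ^+ 2 * Q f g.
Proof.
move=> s01 Gf Gg; apply: tlim_Q; [exact: (inG0_mix _ _).1..|].
by apply: tlim_mix => //; apply: trap_cvgQ; [exact: Gf.1|exact: Gg.1].
Qed.

Lemma Q_refl f g : inG f -> inG g -> Q (central_refl f) (central_refl g) = - Q f g.
Proof.
move=> Gf Gg; apply: tlim_Q; [exact: inG_refl..|].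
by apply: tlim_refl; exact: trap_cvgQ.
Qed.

Lemma QC f g : inG f -> inG g -> Q g f = - Q f g.
Proof. by move=> Gf Gg; apply: tlim_Q => //; apply: tlimC; exact: trap_cvgQ. Qed.

End Stieltjes.

(** * Independence under the two operations, a criterion for star-shapedness, and small
    perturbations of the identity *)

Section Families.
Set Implicit Arguments. Unset Strict Implicit.
Variables (R : realType) (n : nat).
Implicit Type f : 'I_n -> R -> R.

(** Averaging a linear relation over [t] and [- t] removes the identity and leaves a relation
    between the even parts. *)
Lemma LINplus_sub : @LINplus R n `<=` @LIN R n.
Proof.
move=> f [f0 indep]; split=> // a c ac.
have c0 : forall j, c j = 0.
  apply: indep => t It; have := ac _ It; have := ac _ (I11N It) => acN acP.
  transitivity (((a * t + \sum_(j < n) c j * f j t) +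
                 (a * - t + \sum_(j < n) c j * f j (- t))) / 2).
    rewrite mulrN addrACA subrr add0r -big_split/= mulr_suml.
    by apply: eq_bigr => j _; rewrite /feven; field.
  by rewrite acP acN addr0 mul0r.
split=> //; have := ac 1 (I11_1 R).
by rewrite big1 ?mulr1 ?addr0// => j _; rewrite c0 mul0r.
Qed.

Lemma LIN_mix (s : R) f : 0 < s <= 1 -> LIN f -> LIN (fun j => mix s (f j)).
Proof.
move=> s01 [f0 indep]; split=> [j|a c ac]; first exact: inG0_mix.
(* A relation between the mixed functions is one between the original functions, with the identity
   parts of all [mix] terms collected in the first coefficient. *)
have [] := indep (a + \sum_(j < n) c j * (1 - s)) (fun j => c j * s).
  move=> t It; apply: etrans (ac _ It); rewrite mulrDl -addrA; congr (_ + _).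
  by rewrite mulr_suml -big_split/=; apply: eq_bigr => j _; rewrite /mix; ring.
move=> a0 cs0; have c0 j : c j = 0.
  by have /eqP := cs0 j; rewrite mulf_eq0 (gt_eqF (x := s)) ?orbF => [/eqP|]; lra.
split=> //; rewrite -a0 big1 ?addr0// => j _; by rewrite c0 mul0r.
Qed.

Lemma LINplus_mix (s : R) f :
  0 < s <= 1 -> LINplus f -> LINplus (fun j => mix s (f j)).
Proof.
move=> s01 [f0 indep]; split=> [j|c ac]; first exact: inG0_mix.
have cs0 : forall j, c j * s = 0.
  apply: indep => t It; apply: etrans (ac _ It).
  by apply: eq_bigr => j _; rewrite /feven /mix; field.
by move=> j; have /eqP := cs0 j; rewrite mulf_eq0 => /orP[/eqP//|/eqP]; lra.
Qed.

Lemma LIN_refl f : LIN f -> LIN (fun j => central_refl (f j)).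
Proof.
move=> [f0 indep]; split=> [j|a c ac]; first exact: inG0_refl.
apply: indep => t It; have := ac _ (I11N It) => acN.
apply: oppr_inj; rewrite oppr0; apply: etrans acN.
rewrite opprD mulrN -sumrN; congr (_ + _).
by apply: eq_bigr => j _; rewrite /central_refl opprK mulrN.
Qed.

Lemma LINplus_refl f : LINplus f -> LINplus (fun j => central_refl (f j)).
Proof.
move=> [f0 indep]; split=> [j|c ac]; first exact: inG0_refl.
apply: indep => t It; apply: oppr_inj; rewrite oppr0; apply: etrans (ac _ It).
rewrite -sumrN.
by apply: eq_bigr => j _; rewrite /feven /central_refl opprK; field.
Qed.

Lemma Qmat_mix (s : R) f : 0 < s <= 1 -> (forall j, inG0 (f j)) ->
  Qmat (fun j => mix s (f j)) = s ^+ 2 *: Qmat f.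
Proof. by move=> s01 f0; apply/matrixP => i j; rewrite !mxE Q_mix. Qed.

Lemma Qmat_refl f : (forall j, inG0 (f j)) ->
  Qmat (fun j => central_refl (f j)) = - Qmat f.
Proof.
move=> f0; apply/matrixP => i j; rewrite !mxE Q_refl//.
  exact: (f0 j).1.
exact: (f0 i).1.
Qed.

Lemma Qmat_antisym f : (forall j, inG0 (f j)) -> antisym (Qmat f).
Proof.
move=> f0; apply/matrixP => i j; rewrite !mxE QC//.
  exact: (f0 j).1.
exact: (f0 i).1.
Qed.

(** Contraction and negation make [C] meet each line through 0 in a symmetric interval; one point at
    a positive parameter on it already yields a neighbourhood of 0. *)
Lemma star_shaped_of_rays (V C : set 'M[R]_n) : V 0 ->
  (forall M (s : R), 0 < s <= 1 -> C M -> C (s *: M)) ->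
  (forall M, C M -> C (- M)) ->
  (forall M, V M -> exists2 e : R, 0 < e & C (e *: M)) ->
  star_shaped V C.
Proof.
move=> V0 Cscale Copp Cray.
(* The ray hypothesis is applied to the zero matrix, all of whose multiples are zero. *)
have C0 : C 0 by have [e _] := Cray _ V0; rewrite scaler0.
have Csub M (x z : R) : C (x *: M) -> `|z| <= `|x| -> C (z *: M).
  have [->|x0] := eqVneq x 0.
    by move=> _; rewrite normr0 normr_le0 => /eqP ->; rewrite scale0r.
  move=> CxM zx; have [->|z0] := eqVneq z 0; first by rewrite scale0r.
  have z1 : 0 < `|z / x| <= 1.
    by rewrite normr_gt0 mulf_neq0 ?invr_eq0//= normf_div ler_pdivrMr ?normr_gt0// mul1r.
  have := Cscale _ _ z1 CxM; rewrite scalerA.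
  have [_|_] := ger0P (z / x); first by rewrite divfK.
  by rewrite mulNr divfK// scaleNr => /Copp; rewrite opprK.
move=> v Vv _; split.
  (* A point between [x] and [y] is dominated in absolute value by one of them: if not by [x], it is
     nonnegative and bounded by [y]. *)
  move=> x y /= Cx Cy z /andP[xz zy].
  have [zx|zx] := leP `|z| `|x|; first exact: Csub zx.
  apply: Csub Cy _; move: zx; have [z0|z0] := leP 0 z.
    by rewrite (ger0_norm z0) => _; rewrite (le_trans zy)// ler_norm.
  by rewrite (ltr0_norm z0) (ltr0_norm (le_lt_trans xz z0)) => ?; lra.
have [e e0 Ce] := Cray _ Vv; exists e => // x xe.
by apply: Csub Ce _; rewrite (gtr0_norm e0) ltW.
Qed.

(** If [d] times each Lipschitz constant is below 1, the perturbation cannot destroy strict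
    monotonicity; the end values then force the range into [I11]. *)
Lemma lipschitz_inG (h : 'I_n -> R -> R) : (forall j, lipschitz_real (h j)) ->
  (forall j, h j (-1) = 0) -> (forall j, h j 1 = 0) ->
  exists2 d : R, 0 < d & forall j, inG (fun t => t + d * h j t).
Proof.
move=> /choice[K hK] hN1 h1.
(* A common strict bound for all the constants, positive even for an empty family; [d] is its
   inverse. *)
pose L := 1 + \sum_j `|K j|.
have L0 : 0 < L by rewrite ltr_pwDl// sumr_ge0.
have KL j : K j < L.
  rewrite /L (bigD1 j)//=; have := ler_norm (K j).
  have : 0 <= \sum_(i < n | i != j) `|K i| by rewrite sumr_ge0.
  by lra.
exists L^-1; first by rewrite invr_gt0.
move=> j.
have inc x y : x < y -> x + L^-1 * h j x < y + L^-1 * h j y.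
  move=> xy; have := hK j x y (ltW xy); have := ler_norm (- (h j y - h j x)).
  rewrite normrN => hn1 hn2.
  have : h j x - h j y < L * (y - x) by have := KL j; nra.
  rewrite -ltr_pdivrMl// => hlt; have := hlt; rewrite mulrBr; lra.
split.
  rewrite (_ : (fun t => _) = (fun t => 1 * t + L^-1 * h j t)); last first.
    by apply/funext => t; rewrite mul1r.
  apply: continuous_comb; apply/I11_continuousP => x e Ix e0.
  exists (e / L); first by rewrite divr_gt0.
  move=> y Iy xy.
  have KL' z : 0 < z -> K j * z < L * z by move=> z0; rewrite ltr_pM2r.
  move: xy; rewrite ltr_pdivlMr// mulrC => xy.
  have [xley|xley|->] := ltgtP x y; last by rewrite subrr normr0.
    rewrite distrC; apply: le_lt_trans (hK j x y (ltW xley)) _.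
    by move: xy; rewrite distrC gtr0_norm ?subr_gt0//; have := KL' (y - x); lra.
  apply: le_lt_trans (hK j y x (ltW xley)) _.
  by move: xy; rewrite gtr0_norm ?subr_gt0//; have := KL' (x - y); lra.
split=> [x /I11_le/andP[x1 x2]|].
  have le_inc a b : a <= b -> a + L^-1 * h j a <= b + L^-1 * h j b.
    by rewrite le_eqVlt => /predU1P[->//|/inc/ltW].
  apply/I11_le; have := le_inc _ _ x1; have := le_inc _ _ x2.
  by rewrite hN1 h1 !mulr0 !addr0 => -> ->.
split=> [x y _ _|]; first exact: inc.
by rewrite hN1 h1 !mulr0 !addr0.
Qed.
End Families.

(** * Trigonometric perturbations of the identity that realize a multiple of a given anti-symmetric
    matrix *)

Section Rays.
Set Implicit Arguments. Unset Strict Implicit.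
Variable R : realType.
Implicit Types (f g h : R -> R).

Lemma lipschitz_add f g : lipschitz_real f -> lipschitz_real g ->
  lipschitz_real (fun t => f t + g t).
Proof.
move=> [K fK] [L gL]; exists (K + L) => s t st.
rewrite mulrDl opprD addrACA; apply: le_trans (ler_normD _ _) _.
by rewrite lerD ?fK ?gL.
Qed.

Lemma lipschitz_scale (a : R) f : lipschitz_real f ->
  lipschitz_real (fun t => a * f t).
Proof.
move=> [K fK]; exists (`|a| * K) => s t st.
by rewrite -mulrBr normrM -mulrA ler_wpM2l ?fK.
Qed.

Lemma lipschitz_sum n (F : 'I_n -> R -> R) :
  (forall j, lipschitz_real (F j)) -> lipschitz_real (fun t => \sum_(j < n) F j t).
Proof.
move=> /choice[K FK]; exists (\sum_(j < n) K j) => s t st.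
rewrite -sumrB mulr_suml; apply: le_trans (ler_norm_sum _ _ _) _.
by apply: ler_sum => j _; exact: FK.
Qed.

Lemma lipschitz_sin (a : R) : lipschitz_real (fun t => sin (a * t)).
Proof.
exists `|a|; apply: derive_bounded_lipschitz (is_derive_sin_linear a) _ => x.
by rewrite normrM ler_piMr// cos_max.
Qed.

Lemma lipschitz_cos (a : R) : lipschitz_real (fun t => cos (a * t)).
Proof.
exists `|a|; apply: derive_bounded_lipschitz (is_derive_cos_linear a) _ => x.
by rewrite normrN normrM ler_piMr// sin_max.
Qed.

(** Frequencies start at 2, leaving frequency 1 to the cosine subtracted in [even_mode], which is
    thus orthogonal to all odd modes. *)
Definition odd_mode (k : nat) (t : R) : R := sin (freq R k.+2 * t).
(* Subtracting the first cosine makes the mode vanish at [-1] and [1] while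
   keeping it of mean zero. *)
Definition even_mode (j : nat) (t : R) : R :=
  cos (freq R j.+2 * t) + -1 * cos (freq R 1 * t).

Lemma odd_modeN k t : odd_mode k (- t) = -1 * odd_mode k t.
Proof. by rewrite /odd_mode mulrN sinN mulN1r. Qed.

Lemma even_modeN j t : even_mode j (- t) = even_mode j t.
Proof. by rewrite /even_mode !mulrN !cosN. Qed.

Lemma odd_mode1 k : odd_mode k 1 = 0.
Proof. by rewrite /odd_mode mulr1 sin_freq. Qed.

Lemma even_mode1 j : even_mode j 1 = 0.
Proof. by rewrite /even_mode !mulr1 !cos_freq; ring. Qed.

Lemma tlim_even_mode_id j : tlim (even_mode j) id 0.
Proof.
have -> : 0 = -1 + -1 * -1 :> R by ring.
by apply: tlimDl; [|apply: tlimZl]; exact: trap_cos_id.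
Qed.

Lemma tlim_modes k j :
  tlim (odd_mode k) (even_mode j) (- (freq R k.+2 * (j == k)%:R)).
Proof.
have -> : - (freq R k.+2 * (j == k)%:R) = - (freq R k.+2 * (j.+2 == k.+2)%:R) +
    -1 * - (freq R k.+2 * (1%N == k.+2)%:R).
  by rewrite !eqSS/=; ring.
by apply: tlimDr; [|apply: tlimZr]; exact: trap_sin_cos.
Qed.

Variable n : nat.
Implicit Type M : 'M[R]_n.

(* The factor [2] compensates for the two equal contributions [M i j / 2] and
   [- M j i / 2] to the entry [(i, j)]. *)
Definition odd_part M (i : 'I_n) (t : R) : R :=
  \sum_(k < n) M i k / (2 * freq R k.+2) * odd_mode k t.

Definition perturbation M (i : 'I_n) (t : R) : R := even_mode i t + odd_part M i t.

Lemma odd_partN M i t : odd_part M i (- t) = -1 * odd_part M i t.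
Proof.
rewrite /odd_part mulr_sumr; apply: eq_bigr => k _.
by rewrite odd_modeN mulrCA.
Qed.

Lemma perturbation1 M i : perturbation M i 1 = 0.
Proof.
rewrite /perturbation even_mode1 add0r /odd_part big1// => k _.
by rewrite odd_mode1 mulr0.
Qed.

Lemma perturbationN1 M i : perturbation M i (-1) = 0.
Proof.
rewrite /perturbation even_modeN even_mode1 add0r odd_partN /odd_part big1 ?mulr0// => k _.
by rewrite odd_mode1 mulr0.
Qed.

Lemma lipschitz_perturbation M i : lipschitz_real (perturbation M i).
Proof.
apply: lipschitz_add.
  by apply: lipschitz_add; [|apply: lipschitz_scale]; exact: lipschitz_cos.
by apply: lipschitz_sum => k; apply: lipschitz_scale; exact: lipschitz_sin.
Qed.

(** By orthogonality only the mode [k = j] survives, and its frequency cancels against the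
    denominator in [odd_part]. *)
Lemma tlim_odd_even M (i j : 'I_n) : tlim (odd_part M i) (even_mode j) (- (M i j / 2)).
Proof.
have -> : - (M i j / 2) = \sum_(k < n)
    M i k / (2 * freq R k.+2) * - (freq R k.+2 * (j == k :> nat)%:R).
  rewrite (bigD1 j)//= eqxx big1 => [|k kj].
    by rewrite addr0 mulr1; field; rewrite gt_eqF ?freq_gt0.
  by rewrite eq_sym (negPf (kj : k != j :> nat)) mulr0 oppr0 mulr0.
by apply: tlim_suml => k; apply: tlimZl; exact: tlim_modes.
Qed.

Lemma tlim_perturbation_id M i : tlim (perturbation M i) id 0.
Proof.
rewrite -[0]addr0; apply: tlimDl; first exact: tlim_even_mode_id.
apply: tlim_const => m; apply: (@trap_parity _ _ (-1) (-1)) => [|t|t]; first ring.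
  exact: odd_partN.
by rewrite mulN1r.
Qed.

Lemma tlim_perturbation M i j : antisym M ->
  tlim (perturbation M j) (perturbation M i) (M i j).
Proof.
move=> /matrixP/(_ j i); rewrite !mxE => Mij.
(* Pairings of equal parity vanish, and the two mixed ones give [M i j / 2] and [- (M j i / 2)],
   which agree by antisymmetry. *)
have -> : M i j = (0 + - - (M i j / 2)) + (- (M j i / 2) + 0) by rewrite Mij; field.
apply: tlimDl; apply: tlimDr.
- apply: tlim_const => m; apply: (@trap_parity _ _ 1 1) => [|t|t]; first ring.
    by rewrite even_modeN mul1r.
  by rewrite even_modeN mul1r.
- by apply: tlimC; exact: tlim_odd_even.
- exact: tlim_odd_even.
- apply: tlim_const => m; apply: (@trap_parity _ _ (-1) (-1)) => [|t|t]; first ring.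
    exact: odd_partN.
  exact: odd_partN.
Qed.

Lemma antisym_ray_LINplus M : antisym M ->
  exists2 e : R, 0 < e & (@Qmat R n @` @LINplus R n) (e *: M).
Proof.
move=> aM.
have [d d0 Gf] := lipschitz_inG (lipschitz_perturbation M)
  (perturbationN1 M) (perturbation1 M).
pose f j t := t + d * perturbation M j t.
exists (d ^+ 2); first by rewrite exprn_gt0.
have id_id : tlim (@id R) id 0 by apply: tlim_const => m; rewrite trap_self.
have pert_id i : tlim (perturbation M i) id 0 by exact: tlim_perturbation_id.
have id_pert i : tlim id (perturbation M i) 0 by rewrite -oppr0; exact: tlimC.
exists f; last first.
  apply/matrixP => i j; rewrite !mxE; apply: tlim_Q; [exact: Gf..|].
  (* The perturbations have mean zero, so all terms involving the identity vanish and only the part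
     quadratic in [d] remains. *)
  have -> : d ^+ 2 * M i j = (0 + d * 0) + d * (0 + d * M i j) by ring.
  apply: tlimDl; [|apply: tlimZl]; apply: tlimDr => //; apply: tlimZr => //.
  exact: tlim_perturbation.
split=> [j|c c0 k].
  apply/inG0P; split; first exact: Gf.
  have -> : 0 = 0 + d * 0 :> R by ring.
  by apply: tlimDl => //; exact: tlimZl.
have evenE j t : feven (f j) t = d * even_mode j t.
  by rewrite /feven /f /perturbation even_modeN odd_partN; field.
(* Independence of the even parts: a vanishing combination is paired with [odd_mode k]. The result
   is 0, and by orthogonality it is also a nonzero multiple of [c k]. *)
have lim0 : tlim (odd_mode k) (fun t => \sum_(j < n) c j * feven (f j) t) 0.
  apply: (@tlim_eq _ _ (odd_mode k) _ (fun t => 0 * odd_mode k t)) => //.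
    by move=> t It; rewrite c0// mul0r.
  have self0 : tlim (odd_mode k) (odd_mode k) 0.
    by apply: tlim_const => m; rewrite trap_self.
  by have := tlimZr (a := 0) self0; rewrite mulr0.
have lim1 : tlim (odd_mode k) (fun t => \sum_(j < n) c j * feven (f j) t)
    (\sum_(j < n) c j * (d * - (freq R k.+2 * (j == k :> nat)%:R))).
  apply: tlim_sumr => j; apply: tlimZr.
  apply: (@tlim_eq _ _ (odd_mode k) _ (fun t => d * even_mode j t)) => //.
  by apply: tlimZr; exact: tlim_modes.
have := tlim_unique lim1 lim0; rewrite (bigD1 k)//= eqxx big1 => [|j jk].
  move/eqP; rewrite addr0 mulr1 mulf_eq0 => /orP[/eqP//|].
  by rewrite mulrN oppr_eq0 gt_eqF// mulr_gt0 ?freq_gt0.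
by rewrite (negPf (jk : j != k :> nat)) mulr0 oppr0 !mulr0.
Qed.
End Rays.

Theorem theorem4p14 (R : realType) (n : nat) :
  let Cplus : set 'M[R]_n := (@Qmat R n) @` (@LINplus R n) in
  let C : set 'M[R]_n := (@Qmat R n) @` (@LIN R n) in
  Cplus `<=` C /\ C `<=` @antisym R n /\
  star_shaped (@antisym R n) Cplus /\ star_shaped (@antisym R n) C.
Proof.
move=> Cplus C.
have sub : Cplus `<=` C by move=> M [f /LINplus_sub Lf <-]; exists f.
have anti0 : @antisym R n 0 by rewrite /antisym/= trmx0 oppr0.
split=> //; split=> [M [f [f0 _] <-]|]; first exact: Qmat_antisym.
(* Mixing with parameter [s] scales the matrix by [s ^+ 2], so a factor [s] is realized with
   parameter [Num.sqrt s]. *)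
have sqrt01 (s : R) : 0 < s <= 1 -> 0 < Num.sqrt s <= 1.
  by move=> /andP[s0 s1]; rewrite sqrtr_gt0 s0/= -[leRHS]sqrtr1 ler_sqrt.
split; apply: star_shaped_of_rays => //.
- move=> _ s s01 [f Lf <-].
  exists (fun j => mix (Num.sqrt s) (f j)); first exact: LINplus_mix (sqrt01 _ s01) Lf.
  rewrite (Qmat_mix (sqrt01 _ s01) Lf.1) sqr_sqrtr//.
  by have /andP[/ltW] := s01.
- move=> _ [f Lf <-]; exists (fun j => central_refl (f j)); first exact: LINplus_refl.
  by rewrite Qmat_refl//; case: Lf.
- exact: antisym_ray_LINplus.
- move=> _ s s01 [f Lf <-].
  exists (fun j => mix (Num.sqrt s) (f j)); first exact: LIN_mix (sqrt01 _ s01) Lf.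
  rewrite (Qmat_mix (sqrt01 _ s01) Lf.1) sqr_sqrtr//.
  by have /andP[/ltW] := s01.
- move=> _ [f Lf <-]; exists (fun j => central_refl (f j)); first exact: LIN_refl.
  by rewrite Qmat_refl//; case: Lf.
(* The multiple found in the smaller set [Cplus] serves for [C] as well. *)
- by move=> M /antisym_ray_LINplus[e e0 /sub]; exists e.
Qed.
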